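(* Let $f,g:2^V\to\mathbb{R}$ be submodular functions on a finite ground set $V$ with $|V|=n$, $g(\emptyset)=0$, and let $v(X)=f(X)-g(X)$. Consider the modular-modular (ModMod) procedure described in the context, producing sets $X^0=\emptyset,X^1,X^2,\dots$. (1) The objective value is monotonically decreased at every iteration: $v(X^{t+1})\le v(X^t)$ for every $t$, whichever modular upper bound and whichever permutation (with chain containing $X^t$) is used. (2) Let $X^t$ be the current set and let $\Sigma$ be a family of $O(n)$ permutations of $V$, each of whose chains contains $X^t$, with different elements at the positions adjacent to $X^t$, in the sense that every $j\in X^t$ equals $\sigma(|X^t|)$ for some $\sigma\in\Sigma$ and every $j\in V\setminus X^t$ equals $\sigma(|X^t|+1)$ for some $\sigma\in\Sigma$. If for every $\sigma\in\Sigma$ and for both modular upper bounds $i\in\{1,2\}$ the step $Y\in\operatorname{argmin}_X\, m^f_{X^t,i}(X)-h^g_{X^t,\sigma}(X)$ does not decrease the function value, i.e. $v(Y)\ge v(X^t)$, then $X^t$ is a local minimum of $v$.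
   Context: A set function $f:2^V\to\mathbb{R}$ is submodular if $f(S)+f(T)\ge f(S\cup T)+f(S\cap T)$ for all $S,T\subseteq V$. Write $f(A|B)=f(A\cup B)-f(B)$, and $j$ for $\{j\}$. For a set $X\subseteq V$ define two modular upper bounds of $f$ that are tight at $X$: $$m^f_{X,1}(Y)=f(X)-\sum_{j\in X\setminus Y}f(j|X\setminus j)+\sum_{j\in Y\setminus X}f(j|\emptyset),$$ $$m^f_{X,2}(Y)=f(X)-\sum_{j\in X\setminus Y}f(j|V\setminus j)+\sum_{j\in Y\setminus X}f(j|X).$$ For a permutation $\sigma$ of $V$ let $S^\sigma_i=\{\sigma(1),\dots,\sigma(i)\}$, $S^\sigma_0=\emptyset$. The chain of $\sigma$ contains $Y$ if $S^\sigma_{|Y|}=Y$. For such $\sigma$ define the modular lower bound of $g$ by $h^g_{Y,\sigma}(\sigma(1))=g(S^\sigma_1)$, $h^g_{Y,\sigma}(\sigma(i))=g(S^\sigma_i)-g(S^\sigma_{i-1})$ for $i\ge2$, and $h^g_{Y,\sigma}(X)=\sum_{j\in X}h^g_{Y,\sigma}(j)$. ModMod procedure: start with $X^0=\emptyset$. At iteration $t$, choose a permutation $\sigma^t$ whose chain contains $X^t$ and one of the two modular upper bounds $m^f_{X^t}\in\{m^f_{X^t,1},m^f_{X^t,2}\}$, and set $X^{t+1}\in\operatorname{argmin}_{X\subseteq V}\, m^f_{X^t}(X)-h^g_{X^t,\sigma^t}(X)$; stop when $X^{t+1}=X^t$. A set $X$ is a local minimum of $v$ if $v(X)\le v(X\cup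 j)$ for all $j\in V\setminus X$ and $v(X)\le v(X\setminus j)$ for all $j\in X$. *)

(* Defs.v *)
From HB Require Import structures.
From mathcomp Require Import all_boot all_order all_algebra reals.

Set Implicit Arguments.
Unset Strict Implicit.
Unset Printing Implicit Defensive.

Import Order.TTheory GRing.Theory Num.Theory.

Local Open Scope ring_scope.

Definition submodular (R : realType) (V : finType) (f : {set V} -> R) : Prop :=
  forall S T : {set V}, f (S :|: T) + f (S :&: T) <= f S + f T.

Definition gain (R : realType) (V : finType) (f : {set V} -> R)
    (A B : {set V}) : R :=
  f (A :|: B) - f B.

Variant bound := Bound1 | Bound2.

Definition upper (R : realType) (V : finType) (f : {set V} -> R) (i : bound)
    (X Y : {set V}) : R :=
  match i with
  | Bound1 => f X - \sum_(j in X :\: Y) gain f [set j] (X :\ j)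
                  + \sum_(j in Y :\: X) gain f [set j] set0
  | Bound2 => f X - \sum_(j in X :\: Y) gain f [set j] ([set: V] :\ j)
                  + \sum_(j in Y :\: X) gain f [set j] X
  end.

(* A permutation of V is an ordering sigma(1), ..., sigma(n) of its elements,
   represented by the tuple of these values. *)
Definition permutation (V : finType) (s : #|V|.-tuple V) : Prop :=
  perm_eq s (enum V).

(* The 1-based position: for a permutation s, [pos s j = i] is s(i) = j. *)
Definition pos (V : finType) (s : #|V|.-tuple V) (j : V) : nat :=
  (index j s).+1.

Definition chain (V : finType) (s : #|V|.-tuple V) (i : nat) : {set V} :=
  [set j in take i s].

Definition chain_contains (V : finType) (s : #|V|.-tuple V) (Y : {set V})
    : Prop :=
  chain s #|Y| = Y.

(* The weights of h^g_{Y,s} depend on Y only through the requirement that the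
   chain of s contains Y, so Y is not an argument here. *)
Definition lower_wt (R : realType) (V : finType) (g : {set V} -> R)
    (s : #|V|.-tuple V) (j : V) : R :=
  if pos s j == 1%N then g (chain s 1)
  else g (chain s (pos s j)) - g (chain s (pos s j).-1).

Definition lower (R : realType) (V : finType) (g : {set V} -> R)
    (s : #|V|.-tuple V) (X : {set V}) : R :=
  \sum_(j in X) lower_wt g s j.

Definition is_argmin (R : realType) (V : finType) (F : {set V} -> R)
    (Y : {set V}) : Prop :=
  forall Z : {set V}, F Y <= F Z.

Definition modmod_step (R : realType) (V : finType) (f g : {set V} -> R)
    (s : #|V|.-tuple V) (i : bound) (X Y : {set V}) : Prop :=
  is_argmin (fun Z => upper f i X Z - lower g s Z) Y.

(* X 0, ..., X T are the sets produced by T iterations of the procedure, with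
   the choices s t and i t at iteration t; iteration t.+1 takes place only if
   the procedure did not stop after iteration t. *)
Definition modmod_run (R : realType) (V : finType) (f g : {set V} -> R)
    (T : nat) (X : nat -> {set V}) (s : nat -> #|V|.-tuple V)
    (i : nat -> bound) : Prop :=
  [/\ X 0%N = set0,
      forall t, (t < T)%N ->
        [/\ permutation (s t), chain_contains (s t) (X t)
          & modmod_step f g (s t) (i t) (X t) (X t.+1)]
    & forall t, (t.+1 < T)%N -> X t.+1 <> X t].

Definition local_min (R : realType) (V : finType) (v : {set V} -> R)
    (X : {set V}) : Prop :=
  (forall j, j \notin X -> v X <= v (j |: X)) /\
  (forall j, j \in X -> v X <= v (X :\ j)).

(* Main.v *)
(* Submodularity makes both [upper f i X] pointwise majorants of [f] and
   [lower g s] a minorant of [g]; they are exact at [X], respectively on the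
   chain of [s].  A step from [X] to [Y] therefore gives
   v Y <= upper Y - lower Y <= upper Z - lower Z for every Z, and Z := X is (1).
   For (2), the second upper bound is also exact at [j |: X] and the first one
   at [X :\ j], and these sets lie on the chain as soon as [j] is adjacent to
   [X] in [s], so that Z can be taken to be any neighbour of [X]. *)
Require Import Defs.
From HB Require Import structures.
From mathcomp Require Import all_boot all_order all_algebra reals lra.

Set Implicit Arguments.
Unset Strict Implicit.
Unset Printing Implicit Defensive.

Import Order.TTheory GRing.Theory Num.Theory.

Local Open Scope ring_scope.

Section SubmodularBounds.

Variables (R : realType) (V : finType).
Implicit Types (f g : {set V} -> R) (A B W X Y Z : {set V}) (j : V).
Implicit Types (s : #|V|.-tuple V).

(** * Marginal gains and the modular upper bounds *)

Lemma submodular_gain f A B j :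
  submodular f -> A \subset B -> j \notin B ->
  gain f [set j] B <= gain f [set j] A.
Proof.
(* The union of [j |: A] and [B] is [j |: B]; their intersection is [A], because [j] lies outside
   [B]. *)
move=> f_submod sAB jNB; have := f_submod (j |: A) B.
rewrite -setUA (setUidPr sAB) setIUl (setIidPl sAB).
have -> : [set j] :&: B = set0.
  by apply/setP=> k; rewrite !inE; case: eqP => // ->; apply/negbTE.
by rewrite set0U /gain; lra.
Qed.

Lemma gain_setD1 f X j : j \in X -> gain f [set j] (X :\ j) = f X - f (X :\ j).
Proof. by move=> jX; rewrite /gain setD1K. Qed.

(** Add the elements of [W] one at a time: each joins a set that contains [A], so by diminishing
    returns it contributes at most its gain over [A]. [Bound1] takes [A := set0], [Bound2] takes
    [A := X]. *)
Lemma setU_le_gain f A X W :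
  submodular f -> A \subset X -> [disjoint W & X] ->
  f (X :|: W) <= f X + \sum_(j in W) gain f [set j] A.
Proof.
move=> f_submod sAX; have [m] := ubnP #|W|; elim: m W => // m IHm W.
have [->|[j jW]] := set_0Vmem W; first by rewrite setU0 big_set0 addr0.
rewrite (cardsD1 j) jW ltnS => leWm dWX.
have /IHm -/(_ leWm) IHj : [disjoint W :\ j & X].
  by apply: disjointWl dWX; rewrite subD1set.
have jN : j \notin X :|: W :\ j by rewrite !inE eqxx orbF (disjointFr dWX).
rewrite -[W in f (_ :|: W)](setD1K jW) setUCA (big_setD1 j) //=.
have := submodular_gain f_submod (subset_trans sAX (subsetUl _ _)) jN.
by rewrite {1}/gain; lra.
Qed.

(** Dually, remove the elements of [W] one at a time: each leaves a subset of [B], so the loss is at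
    least its gain over [B :\ j]. [Bound1] takes [B := X], [Bound2] takes [B := setT]. *)
Lemma setD_le_gain f B X W :
  submodular f -> X \subset B -> W \subset X ->
  f (X :\: W) <= f X - \sum_(j in W) gain f [set j] (B :\ j).
Proof.
move=> f_submod sXB; have [m] := ubnP #|W|; elim: m W => // m IHm W.
have [->|[j jW]] := set_0Vmem W; first by rewrite setD0 big_set0 subr0.
rewrite (cardsD1 j) jW ltnS => leWm sWX.
have IHj := IHm _ leWm (subset_trans (subD1set _ _) sWX).
have jX : j \in X :\: (W :\ j) by rewrite !inE eqxx (subsetP sWX).
have -> : X :\: W = (X :\: (W :\ j)) :\ j.
  by rewrite setDDl setUC setD1K.
rewrite (big_setD1 j) //=.
have jN : j \notin B :\ j by rewrite !inE eqxx.
have sDB : (X :\: (W :\ j)) :\ j \subset B :\ j.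
  by rewrite setSD // (subset_trans (subsetDl _ _)).
have := submodular_gain f_submod sDB jN.
by rewrite (gain_setD1 _ jX); lra.
Qed.

(** The two bounds are two routes from [X] to [Y]. [Bound1] goes down to [X :&: Y] and then up, so
    that removals happen inside [X]; [Bound2] goes up to [X :|: Y] and then down, so that additions
    happen above [X]. *)
Lemma upper_ge f k X Y : submodular f -> f Y <= upper f k X Y.
Proof.
move=> f_submod; case: k => /=.
- have dis : [disjoint Y :\: X & X :&: Y].
    rewrite disjoints_subset; apply/subsetP=> j.
    by rewrite !inE => /andP[/negbTE->].
  have := setU_le_gain f_submod (sub0set _) dis.
  have := setD_le_gain f_submod (subxx X) (subsetDl X Y).
  by rewrite setDDr setDv set0U [X :&: Y]setIC setID; lra.
- have dis : [disjoint Y :\: X & X].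
    rewrite disjoints_subset; apply/subsetP=> j.
    by rewrite !inE => /andP[/negbTE->].
  have sD : X :\: Y \subset X :|: Y by rewrite subDset setUCA setUid subsetUl.
  have := setU_le_gain f_submod (subxx X) dis.
  have := setD_le_gain f_submod (subsetT _) sD.
  have -> : (X :|: Y) :\: (X :\: Y) = Y.
    by apply/setP=> j; rewrite !inE; case: (j \in X); case: (j \in Y).
  have -> : X :|: (Y :\: X) = X :|: Y.
    by apply/setP=> j; rewrite !inE; case: (j \in X).
  by lra.
Qed.

Lemma upper_tight f k X : upper f k X X = f X.
Proof. by case: k; rewrite /= setDv !big_set0 subr0 addr0. Qed.

Lemma upper1_setD1 f X j : j \in X -> upper f Bound1 X (X :\ j) = f (X :\ j).
Proof.
move=> jX; rewrite /= setDDr setDv set0U (setIidPr _) ?sub1set //.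
have -> : (X :\ j) :\: X = set0 by apply/eqP; rewrite setD_eq0 subD1set.
by rewrite big_set0 big_set1 gain_setD1 //; lra.
Qed.

Lemma upper2_setU1 f X j :
  j \notin X -> upper f Bound2 X (j |: X) = f (j |: X).
Proof.
move=> jX; have -> : upper f Bound2 X (j |: X) = f X + gain f [set j] X.
  rewrite /=; have -> : X :\: (j |: X) = set0.
    by apply/eqP; rewrite setD_eq0 subsetUr.
  rewrite setDUl setDv setU0 (setDidPl _) ?disjoints1 // big_set1.
  by rewrite big_set0 subr0.
by rewrite /gain; lra.
Qed.

(** * Chains of a permutation and the modular lower bound *)

Lemma chain0 s : chain s 0 = set0.
Proof. by apply/setP=> j; rewrite !inE take0. Qed.

Lemma permutation_mem s j : permutation s -> j \in s.
Proof. by move=> /perm_mem ->; rewrite mem_enum. Qed.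

Lemma index_ltn_card s j : permutation s -> (index j s < #|V|)%N.
Proof.
move=> s_perm; have := permutation_mem j s_perm.
by rewrite -index_mem size_tuple.
Qed.

Lemma mem_chain s k j : permutation s -> (j \in chain s k) = (index j s < k)%N.
Proof. by move=> s_perm; rewrite inE in_take // permutation_mem. Qed.

Lemma chain_card s : permutation s -> chain s #|V| = setT.
Proof.
by move=> s_perm; apply/setP=> j; rewrite mem_chain // index_ltn_card // inE.
Qed.

Lemma chain_index s j :
  permutation s -> chain s (index j s).+1 = j |: chain s (index j s).
Proof.
move=> s_perm; apply/setP=> k; rewrite in_setU1 !mem_chain // ltnS leq_eqVlt.
congr (_ || _); apply/eqP/eqP => [|-> //].
by apply: (@index_inj _ j) => //; apply: permutation_mem.
Qed.

Lemma chain_step s k :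
  permutation s -> (k < #|V|)%N -> exists j, index j s = k.
Proof.
(* [nth] needs a default element of [V], which [k < #|V|] provides. *)
move=> s_perm ltk; have V_gt0 : (0 < #|V|)%N by apply: leq_ltn_trans ltk.
have /card_gt0P[j0 _] := V_gt0.
exists (nth j0 s k); rewrite index_uniq ?size_tuple //.
by rewrite (perm_uniq s_perm) enum_uniq.
Qed.

(** Since [g set0 = 0], the separate case of the first position is the general difference taken from
    [chain s 0]. *)
Lemma lower_wtE g s j : g set0 = 0 ->
  lower_wt g s j = g (chain s (index j s).+1) - g (chain s (index j s)).
Proof.
move=> g0; rewrite /lower_wt /pos /= eqSS; case: eqP => // ->.
by rewrite chain0 g0 subr0.
Qed.

(** The weights telescope along the chain. *)
Lemma lower_chain g s k : g set0 = 0 -> permutation s -> (k <= #|V|)%N ->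
  lower g s (chain s k) = g (chain s k).
Proof.
move=> g0 s_perm; elim: k => [_|k IHk ltk].
  by rewrite chain0 /lower big_set0 g0.
have [j jk] := chain_step s_perm ltk.
rewrite -jk chain_index // /lower big_setU1 ?mem_chain ?ltnn //=.
rewrite lower_wtE // chain_index // jk.
by move: (IHk (ltnW ltk)); rewrite /lower => ->; rewrite subrK.
Qed.

Lemma lower_le g s Y : submodular g -> g set0 = 0 -> permutation s ->
  lower g s Y <= g Y.
Proof.
move=> g_submod g0 s_perm.
(* Induct on the traces of [Y] on the chain. When [j] in [Y] enters, its weight is its gain over the
   whole prefix, hence at most its gain over the part of the prefix inside [Y]; otherwise the trace
   is unchanged. *)
suff le_chain k : (k <= #|V|)%N ->
    lower g s (Y :&: chain s k) <= g (Y :&: chain s k).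
  by have := le_chain _ (leqnn _); rewrite chain_card // setIT.
elim: k => [_|k IHk ltk]; first by rewrite chain0 setI0 /lower big_set0 g0.
have {IHk} := IHk (ltnW ltk).
have [j jk] := chain_step s_perm ltk.
have jNC : j \notin chain s k by rewrite mem_chain // jk ltnn.
have CS : chain s k.+1 = j |: chain s k by rewrite -jk chain_index.
rewrite CS setIUr; have [jY|jNY] := boolP (j \in Y); last first.
  suff -> : Y :&: [set j] = set0 by rewrite set0U.
  by apply/disjoint_setI0; rewrite disjoint_sym disjoints1.
have /setIidPr-> : [set j] \subset Y by rewrite sub1set.
rewrite /lower big_setU1 /=; last first.
  by rewrite inE (negbTE jNC) andbF.
have := submodular_gain g_submod (subsetIr Y (chain s k)) jNC.
by rewrite lower_wtE // jk CS /gain; lra.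
Qed.

Lemma lower_tight g s X : g set0 = 0 -> permutation s -> chain_contains s X ->
  lower g s X = g X.
Proof. by move=> g0 s_perm <-; rewrite lower_chain ?max_card. Qed.

Lemma lower_setU1 g s X j : g set0 = 0 -> permutation s ->
  chain_contains s X -> pos s j = #|X|.+1 -> lower g s (j |: X) = g (j |: X).
Proof.
(* Positions count from 1 and [index] from 0, so [j] has index [#|X|] and comes right after the
   prefix [X]. *)
move=> g0 s_perm sX [jX]; have jXE : j |: X = chain s (index j s).+1.
  by rewrite chain_index // jX sX.
by rewrite jXE lower_chain // index_ltn_card.
Qed.

Lemma lower_setD1 g s X j : g set0 = 0 -> permutation s ->
  chain_contains s X -> pos s j = #|X| -> lower g s (X :\ j) = g (X :\ j).
Proof.
(* Here [j] is the last element of the prefix [X]. *)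
move=> g0 s_perm sX jX; have XE : X :\ j = chain s (index j s).
  by rewrite -{1}sX -jX chain_index // setU1K // mem_chain // ltnn.
by rewrite XE lower_chain // ltnW // index_ltn_card.
Qed.

Lemma modmod_step_le f g s k X Y Z :
  submodular f -> submodular g -> g set0 = 0 -> permutation s ->
  modmod_step f g s k X Y -> f Y - g Y <= upper f k X Z - lower g s Z.
Proof.
move=> f_submod g_submod g0 s_perm /(_ Z); apply: le_trans.
by rewrite lerB ?upper_ge ?lower_le.
Qed.

End SubmodularBounds.

Theorem theorem4p2 (R : realType) (V : finType) (n : nat) (cardV : #|V| = n)
    (f g v : {set V} -> R)
    (f_submod : submodular f) (g_submod : submodular g) (g0 : g set0 = 0)
    (vE : forall X : {set V}, v X = f X - g X)
    (T : nat) (X : nat -> {set V}) (s : nat -> #|V|.-tuple V)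
    (i : nat -> bound) (run : modmod_run f g T X s i) :
  (forall t : nat, (t < T)%N -> v (X t.+1) <= v (X t)) /\
  (forall t : nat, (t <= T)%N ->
   forall (C : nat) (Sigma : {set #|V|.-tuple V}),
     (#|Sigma| <= C * n)%N ->
     (forall sigma, sigma \in Sigma ->
        permutation sigma /\ chain_contains sigma (X t)) ->
     (forall j, j \in X t ->
        exists2 sigma, sigma \in Sigma & pos sigma j = #|X t|) ->
     (forall j, j \notin X t ->
        exists2 sigma, sigma \in Sigma & pos sigma j = #|X t|.+1) ->
     (forall sigma, sigma \in Sigma -> forall k : bound,
        exists2 Y : {set V},
          modmod_step f g sigma k (X t) Y & v (X t) <= v Y) ->
     local_min v (X t)).
Proof.
case: run => _ run _; split=> [t /run[s_perm sX stepX]|t _ _ Sigma _].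
  have := modmod_step_le (X t) f_submod g_submod g0 s_perm stepX.
  by rewrite !vE upper_tight lower_tight.
move=> Sigma_chain posX posNX stuck; split=> j jX.
- have [sigma sS jpos] := posNX j jX; have [s_perm sX] := Sigma_chain _ sS.
  (* As [v (X t) <= v Y], it remains to bound [v Y] by the value of [v] at the neighbour. *)
  have [Y stepY /le_trans] := stuck _ sS Bound2; apply.
  have := modmod_step_le (j |: X t) f_submod g_submod g0 s_perm stepY.
  by rewrite !vE upper2_setU1 // lower_setU1.
- have [sigma sS jpos] := posX j jX; have [s_perm sX] := Sigma_chain _ sS.
  have [Y stepY /le_trans] := stuck _ sS Bound1; apply.
  have := modmod_step_le (X t :\ j) f_submod g_submod g0 s_perm stepY.
  by rewrite !vE upper1_setD1 // lower_setD1.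
Qed.
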